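(* Let $k\ge1$, $0<\gamma\le 1$, and let $P_0$ be a probability measure on $\mathbb{R}^k$ with $P_0(H)<\gamma$ for every (affine) hyperplane $H\subset\mathbb{R}^k$. Let $(P_t)_{t\ge1}$ be a sequence of probability measures on $\mathbb{R}^k$ with $P_t\to P_0$ weakly as $t\to\infty$, and suppose that $$\sup_{E\in\mathcal{E}}|P_t(E)-P_0(E)|\to 0,\qquad t\to\infty,$$ where $\mathcal{E}$ is the class of all ellipsoids in $\mathbb{R}^k$. For $t\ge 1$ let $\psi_t\in K_t(\gamma)$ be such that $\psi_t\le\mathbf{1}_{E_t}$, where $E_t=E(T_t(\psi_t),C_t(\psi_t),r_t(\psi_t))$, and suppose there exists $R>0$ such that $\{\psi_t\neq0\}\subset B_R=\{x:\|x\|\le R\}$ for all $t$ sufficiently large. Suppose that $$\det(C_t(\psi_t))-\det(C_t(\phi_t))\to0,\qquad t\to\infty,$$ where $\phi_t$ minimizes $\det(C_t(\phi))$ over $\phi\in K_t(\gamma)$. Then: (i) there exists a convergent subsequence $(T_{t_m}(\psi_{t_m}),C_{t_m}(\psi_{t_m}))$; (ii) the limit point of any convergent subsequence of $(T_t(\psi_t),C_t(\psi_t))$ is an MCD functional at $P_0$, i.e. it is of the form $(T_0(\phi_0),C_0(\phi_0))$ for some $\phi_0\in K_0(\gamma)$ minimizing $\det(C_0(\phi))$ over $\phi\in K_0(\gamma)$.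
   Context: For a probability measure $P$ on $\mathbb{R}^k$ let $K_P(\gamma)$ be the set of measurable functions $\phi:\mathbb{R}^k\to[0,1]$ with $\int\phi\,dP\ge\gamma$ and $\int\|x\|^2\phi(x)\,P(dx)<\infty$. For $\phi\in K_P(\gamma)$ define $$T_P(\phi)=\frac{1}{\int\phi\,dP}\int x\,\phi(x)\,P(dx),\qquad C_P(\phi)=\frac{1}{\int\phi\,dP}\int (x-T_P(\phi))(x-T_P(\phi))'\phi(x)\,P(dx).$$ For $\mu\in\mathbb{R}^k$, $\Sigma$ symmetric positive definite and $\rho>0$, $E(\mu,\Sigma,\rho)=\{x\in\mathbb{R}^k:(x-\mu)'\Sigma^{-1}(x-\mu)\le\rho^2\}$; ellipsoids are sets of this form. Further $r_P(\phi)=\inf\{s>0:P(E(T_P(\phi),C_P(\phi),s))\ge\gamma\}$. For $t\ge0$ write $K_t(\gamma)=K_{P_t}(\gamma)$, $T_t=T_{P_t}$, $C_t=C_{P_t}$, $r_t=r_{P_t}$. Writing $E_t$ presupposes that $C_t(\psi_t)$ is positive definite (under the hyperplane condition on $P_0$ this is automatic for all large $t$). Convergence of pairs is in $\mathbb{R}^k\times\mathbb{R}^{k\times k}$. *)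

(* Defs.v *)
From HB Require Import structures.
From mathcomp Require Import all_boot all_order all_algebra.
From mathcomp Require Import all_classical all_reals all_analysis.

Set Implicit Arguments.
Unset Strict Implicit.
Unset Printing Implicit Defensive.

Import Order.TTheory GRing.Theory Num.Theory.
Import numFieldNormedType.Exports.

Local Open Scope classical_set_scope.
Local Open Scope ring_scope.

(* R^k is 'cV[R]_k with the Borel sigma-algebra of its (product) topology. *)
HB.instance Definition _ (R : realType) (k : nat) :=
  @isMeasurable.Build (sigma_display (@open 'cV[R]_k)) 'cV[R]_k
    <<s @open 'cV[R]_k >>
    (@sigma_algebra0 _ setT _) (@sigma_algebraC _ _)
    (@sigma_algebra_bigcup _ setT _).

Section MCD.
Context {R : realType} {k : nat}.
Implicit Types (P : probability 'cV[R]_k R) (phi : 'cV[R]_k -> R).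

(* The library norm `|x| on 'cV[R]_k is the sup norm, hence this definition. *)
Definition enorm (x : 'cV[R]_k) : R := Num.sqrt (\sum_i x i 0 ^+ 2).

Definition posdefmx (S : 'M[R]_k) : Prop :=
  S^T = S /\ forall x : 'cV[R]_k, x != 0 -> 0 < (x^T *m S *m x) 0 0.

(* The radius lives in \bar R because [mcd_radius] below may be +oo (when
   gamma = 1); in that case the ellipsoid is the whole space. *)
Definition ellipsoid (mu : 'cV[R]_k) (S : 'M[R]_k) (rho : \bar R) :
    set 'cV[R]_k :=
  [set x | ((((x - mu)^T *m invmx S *m (x - mu)) 0 0)%:E <= rho ^+ 2)%E].

Definition ellipsoids : set (set 'cV[R]_k) :=
  [set E | exists mu S (rho : R),
    [/\ posdefmx S, 0 < rho & E = ellipsoid mu S rho%:E]].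

Definition hyperplanes : set (set 'cV[R]_k) :=
  [set H | exists (a : 'cV[R]_k) (b : R),
    a != 0 /\ H = [set x | (a^T *m x) 0 0 = b]].

Definition weak_cvg (P_ : nat -> probability 'cV[R]_k R) P : Prop :=
  forall f : 'cV[R]_k -> R,
    continuous f -> (exists M : R, forall x, `|f x| <= M) ->
    \int[P_ t]_x f x @[t --> \oo] --> \int[P]_x f x.

Definition trimmingK P (gamma : R) : set ('cV[R]_k -> R) :=
  [set phi : 'cV[R]_k -> R | [/\ measurable_fun setT phi,
    (forall x, 0 <= phi x <= 1),
    (gamma%:E <= \int[P]_x (phi x)%:E)%E &
    (\int[P]_x (enorm x ^+ 2 * phi x)%:E < +oo)%E]].

Definition trimmed_mean P phi : 'cV[R]_k :=
  (\int[P]_x phi x)^-1 *: \col_i \int[P]_x (x i 0 * phi x).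

Definition trimmed_cov P phi : 'M[R]_k :=
  let T := trimmed_mean P phi in
  (\int[P]_x phi x)^-1 *:
    \matrix_(i, j) \int[P]_x (((x - T) *m (x - T)^T) i j * phi x).

Definition mcd_radius P (gamma : R) phi : \bar R :=
  ereal_inf [set s%:E | s in [set s : R | 0 < s /\
    (gamma%:E <= P (ellipsoid (trimmed_mean P phi) (trimmed_cov P phi) s%:E))%E]].

Definition mcd_minimizer P (gamma : R) phi : Prop :=
  trimmingK P gamma phi /\
  forall phi', trimmingK P gamma phi' ->
    \det (trimmed_cov P phi) <= \det (trimmed_cov P phi').

End MCD.

(* Main.v *)
(* The measures psi_t P_t live on a fixed ball, so along a subsequence their
   moments of order at most two converge, and these determine (T_t, C_t). The
   limit vector is the moment vector of some test function under P_0, because no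
   linear functional separates it from the moments of continuous test functions;
   the infimum of the distance is attained thanks to an L^2 argument replacing
   weak-* compactness. For minimality, every phi in K_0(gamma) is approximated in
   moments by continuous compactly supported test functions of mass larger than
   gamma, which are admissible for P_t when t is large. *)
Require Import Defs.
From mathcomp Require Import all_boot all_order all_algebra.
From mathcomp Require Import all_classical all_reals all_analysis.
From mathcomp Require Import measurable_realfun.
From mathcomp Require Import ring lra.

Set Implicit Arguments.
Unset Strict Implicit.
Unset Printing Implicit Defensive.

Import Order.TTheory GRing.Theory Num.Theory.
Import numFieldNormedType.Exports.

Local Open Scope classical_set_scope.
Local Open Scope ring_scope.

(** The obstacle is that [psi t] and [P t] vary together and [psi t] is merely measurable, so weak
    convergence says nothing directly about the integrals of [psi t]. A linear functional, however,
    only sees the least value of the integral of phi * L over test functions phi. That value is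
    almost reached by a continuous phi depending on L but not on the measure, and to such a phi weak
    convergence applies. Quadratic monomials are unbounded; multiplying by a continuous cutoff makes
    them admissible and leaves [psi t] unchanged for large t. The mass of an approximating function
    must exceed gamma strictly because weak convergence preserves masses only in the limit; mixing
    in a little of a cutoff of mass close to 1 creates this room. Since gamma is positive no
    limiting mass vanishes, so mean, covariance and determinant depend continuously on the
    moments. *)

Lemma cvg_sumr (R : realType) (I : finType) (U : Type) (F : set_system U)
    (f : I -> U -> R) (a : I -> R) : Filter F ->
  (forall i, f i x @[x --> F] --> a i) ->
  \sum_i f i x @[x --> F] --> \sum_i a i.
Proof. by move=> FF cf; apply: cvg_big => //; exact: add_continuous. Qed.

Lemma cvg_prodr (R : realType) (I : finType) (U : Type) (F : set_system U)
    (f : I -> U -> R) (a : I -> R) : Filter F ->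
  (forall i, f i x @[x --> F] --> a i) ->
  \prod_i f i x @[x --> F] --> \prod_i a i.
Proof. by move=> FF cf; apply: cvg_big => //; exact: mul_continuous. Qed.

(** * Dominated convergence and almost everywhere limits *)

Section ae_limits.
Context {d : measure_display} {T : measurableType d} {R : realType}.
Variable Q : probability T R.
Implicit Types (f g : T -> R) (M : R).

Lemma bounded_integrable f M : measurable_fun setT f ->
  (forall x, `|f x| <= M) -> Q.-integrable setT (EFin \o f).
Proof.
move=> mf fM; apply: measurable_bounded_integrable => //.
  by apply: (le_lt_trans (probability_le1 Q measurableT)); exact: ltry.
exists M; split; first exact: num_real.
by move=> r Mr x _ /=; rewrite (le_trans (fM x))// ltW.
Qed.

Lemma cvg_Rintegral (f_ : nat -> T -> R) f g :
  (forall n, measurable_fun setT (f_ n)) -> measurable_fun setT f ->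
  {ae Q, forall x, f_ ^~ x @ \oo --> f x} ->
  Q.-integrable setT (EFin \o g) ->
  (forall n x, `|f_ n x| <= g x) ->
  \int[Q]_x f_ n x @[n --> \oo] --> \int[Q]_x f x.
Proof.
move=> mf_ mf cf ig fg.
have [If _ cvI] : [/\ Q.-integrable setT (EFin \o f),
    (fun n => \int[Q]_x `|(EFin \o f_ n) x - (EFin \o f) x|)%E @ \oo --> 0%E &
    (fun n => \int[Q]_x (EFin \o f_ n) x)%E @ \oo -->
      (\int[Q]_x (EFin \o f) x)%E].
  apply: (@dominated_convergence _ _ _ Q setT measurableT
    (fun n => EFin \o f_ n) (EFin \o f) (EFin \o g)) => //.
  - by move=> n; apply/measurable_EFinP.
  - exact/measurable_EFinP.
  - by apply: filterS cf => x cx _; apply: cvg_EFin; first exact: nearW.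
  - by apply: aeW => x n _ /=; rewrite lee_fin.
rewrite /Rintegral; apply: fine_cvg.
by rewrite fineK//; exact: integrable_fin_num.
Qed.

Lemma cvg_Rintegral_bounded (f_ : nat -> T -> R) f M :
  (forall n, measurable_fun setT (f_ n)) -> measurable_fun setT f ->
  {ae Q, forall x, f_ ^~ x @ \oo --> f x} ->
  (forall n x, `|f_ n x| <= M) ->
  \int[Q]_x f_ n x @[n --> \oo] --> \int[Q]_x f x.
Proof.
move=> mf_ mf cf fM; apply: (@cvg_Rintegral _ _ (cst M)) => //.
exact: finite_measure_integrable_cst.
Qed.

(** Exchanging sum and integral, the series of absolute increments has integral at most [2 * c],
    hence is finite almost everywhere. At such points the telescoping series converges
    absolutely. *)
Lemma summable_increments_ae_cvg (g_ : nat -> T -> R) (c : R) :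
  (forall n, measurable_fun setT (g_ n)) ->
  (forall n x, 0 <= g_ n x <= 1) -> 0 <= c ->
  (forall n, \int[Q]_x `|g_ n.+1 x - g_ n x| <= c * 2^-1 ^+ n) ->
  {ae Q, forall x, cvgn (g_ ^~ x)}.
Proof.
move=> mg g01 c0 gc; pose f n x := `|g_ n.+1 x - g_ n x|.
have mf n : measurable_fun setT (f n).
  by apply: measurableT_comp => //; exact: measurable_funB.
have f1 n x : `|f n x| <= 1.
  by rewrite /f normr_id; have := g01 n x; have := g01 n.+1 x; rewrite ler_norml; lra.
have fint n : Q.-integrable setT (EFin \o f n) by exact: bounded_integrable (f1 n).
have intE n : (\int[Q]_x (f n x)%:E = (\int[Q]_x f n x)%:E)%E.
  by rewrite /Rintegral fineK//; exact: integrable_fin_num (fint n).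
pose S x := (\sum_(n <oo) (f n x)%:E)%E.
have f0 n x : setT x -> (0 <= (f n x)%:E)%E by rewrite lee_fin normr_ge0.
have Sint : Q.-integrable setT S.
  apply/integrableP; split.
    by apply: ge0_emeasurable_sum => [n x _ _|n _];
      [exact: f0|exact/measurable_EFinP].
  under eq_integral.
    move=> x _; rewrite gee0_abs; last by apply: nneseries_ge0 => n _ _; exact: f0.
    over.
  rewrite /S integral_nneseries//; last by move=> n; exact/measurable_EFinP.
  apply: (@le_lt_trans _ _ (c * (1 - 2^-1)^-1)%:E); last exact: ltry.
  apply: lime_le.
    by apply: is_cvg_nneseries => n _ _; apply: integral_ge0 => x; exact: f0.
  apply: nearW => n; under eq_bigr do rewrite intE.
  rewrite sumEFin lee_fin.
  have : series (geometric c 2^-1) n <= c * (1 - 2^-1)^-1.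
    apply: geometric_le_lim => //.
    by rewrite ger0_norm ?invr_ge0// invf_lt1// ltr1n.
  by rewrite seriesEnat/=; apply: le_trans; apply: ler_sum => i _; exact: gc.
have /integrable_ae := Sint => /(_ measurableT).
apply: filterS => x /(_ I) Sfin.
have : cvgn (series (telescope (g_ ^~ x))).
  apply: normed_cvg; change (cvgn (fun n => \sum_(0 <= i < n) f i x)).
  apply: nondecreasing_is_cvgn.
    by apply/nondecreasing_seqP => n; rewrite big_nat_recr//= lerDl normr_ge0.
  exists (fine (S x)) => _ [n _ <-]; rewrite -lee_fin fineK// /S -sumEFin.
  by apply: nneseries_lim_ge => i _ _; exact: f0.
rewrite telescopeK => /cvgP /= cv.
have -> : g_ ^~ x = (fun n => (g_ n x - g_ 0%N x) + g_ 0%N x).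
  by apply/funext => n; rewrite subrK.
apply: is_cvgD; [exact: cv|exact: is_cvg_cst].
Qed.

End ae_limits.

(** * Almost everywhere limits from nested midpoint-convex sets *)

Section minimal_norm.
Context {d : measure_display} {T : measurableType d} {R : realType}.
Variable Q : probability T R.
Implicit Types (f g phi : T -> R).

Definition test_function phi :=
  measurable_fun setT phi /\ forall x, 0 <= phi x <= 1.

Lemma test_function_norm phi x : test_function phi -> `|phi x| <= 1.
Proof. by case=> _ /(_ x); rewrite ler_norml; lra. Qed.

Lemma test_function_mul_le phi f x M : test_function phi -> `|f x| <= M ->
  `|phi x * f x| <= M.
Proof.
move=> tphi fM; rewrite normrM; apply: le_trans fM.
by rewrite ler_piMl//; exact: test_function_norm.
Qed.

Lemma test_integrable phi f M : test_function phi ->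
  measurable_fun setT f -> (forall x, `|f x| <= M) ->
  Q.-integrable setT (EFin \o (fun x => phi x * f x)).
Proof.
move=> tphi mf fM; apply: (@bounded_integrable _ _ _ _ _ M).
  by apply: measurable_funM => //; case: tphi.
by move=> x; exact: test_function_mul_le.
Qed.

(* The members of C_k of nearly minimal L^2 norm form a fast Cauchy sequence,
   by the parallelogram identity. *)
Lemma midconvex_ae_limit (C : nat -> set (T -> R)) :
  (forall m n, (m <= n)%N -> C n `<=` C m) ->
  (forall n, C n !=set0) ->
  (forall n phi, C n phi -> test_function phi) ->
  (forall n f g, C n f -> C n g -> C n (fun x => (f x + g x) / 2)) ->
  exists g_ : nat -> T -> R, exists2 g, test_function g &
    (forall n, C n (g_ n)) /\ {ae Q, forall x, g_ ^~ x @ \oo --> g x}.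
Proof.
move=> C_dec C_ne C_test C_mid.
pose N2 f := \int[Q]_x (f x * f x).
have isq n f : C n f -> Q.-integrable setT (EFin \o (fun x => f x * f x)).
  move=> Cf; have tf := C_test _ _ Cf.
  by apply: (@test_integrable _ _ 1) => //; [case: tf|move=> x; exact: test_function_norm].
have N2_ge0 f : 0 <= N2 f.
  by apply: Rintegral_ge0 => x _; rewrite -expr2 sqr_ge0.
have N2_le1 n f : C n f -> N2 f <= 1.
  move=> Cf; have tf := C_test _ _ Cf.
  have -> : 1 = \int[Q]_x (cst 1 x) :> R.
    by rewrite Rintegral_cst// mul1r [X in fine X]probability_setT.
  apply: le_Rintegral => //; first exact: isq Cf.
    exact: finite_measure_integrable_cst.
  by move=> x _ /=; have [_ /(_ x)] := tf; nra.
pose a n := inf [set N2 f | f in C n].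
have lba n : has_lbound [set N2 f | f in C n] by exists 0 => _ [f _ <-].
have a_le n f : C n f -> a n <= N2 f by move=> Cf; apply: ge_inf => //; exists f.
have a_le1 n : a n <= 1.
  by have [f Cf] := C_ne n; apply: le_trans (a_le _ _ Cf) (N2_le1 _ _ Cf).
(* Since the sets [C n] shrink, their least squared norms [a n] increase; [s] is the limit of these
   norms. *)
pose s := sup (range a).
have suba : has_sup (range a) by split; [exists (a 0%N), 0%N|exists 1 => _ [n _ <-]].
have a_les n : a n <= s by apply: ub_le_sup; [case: suba|exists n].
(* The tolerance concerns squared norms; its square root [2^-1 ^+ k] is the summable rate wanted for
   the increments. *)
pose e k : R := 4^-1 ^+ k.
have e_gt0 k : 0 < e k by rewrite exprn_gt0.
(* An index beyond [k] is taken at which the infimum is already within [e k] of [s], then a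
   near-minimiser there. The index is kept because the lower bound on midpoints uses it. *)
have exG k : {Nf : nat * (T -> R) | [/\ (k <= Nf.1)%N, C Nf.1 Nf.2,
    s - e k < a Nf.1 & N2 Nf.2 < s + e k]}.
  apply: cid; have [_ [N _ <-] sN] := sup_adherent (e_gt0 k) suba.
  have hinf : has_inf [set N2 f | f in C (maxn k N)].
    by split => //; have [f Cf] := C_ne (maxn k N); exists (N2 f), f.
  have [_ [f Cf <-] fN] := inf_adherent (e_gt0 k) hinf.
  exists (maxn k N, f); split => //=; first exact: leq_maxl.
    apply: (lt_le_trans sN); apply: lb_le_inf; first by case: hinf.
    by move=> _ [h Ch <-]; apply: a_le; apply: C_dec Ch; exact: leq_maxr.
  by apply: (lt_le_trans fN); rewrite lerD2r; exact: a_les.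
pose N_ k := (projT1 (exG k)).1; pose g_ k := (projT1 (exG k)).2.
have gP k : [/\ (k <= N_ k)%N, C (N_ k) (g_ k), s - e k < a (N_ k) & N2 (g_ k) < s + e k].
  exact: (projT2 (exG k)).
have Cg k : C k (g_ k) by have [kN CN _ _] := gP k; exact: C_dec CN.
have tg k : test_function (g_ k) by exact: C_test (Cg k).
have e_dec k : e k.+1 <= e k.
  by rewrite /e exprS ler_piMl ?exprn_ge0// invf_le1// ler1n.
(* The midpoint belongs to the larger of the two nested sets, whose infimum exceeds [s - e k] in
   either case. *)
have mid k : s - e k < N2 (fun x => (g_ k x + g_ k.+1 x) / 2).
  have [kN CN aN _] := gP k; have [kN' CN' aN' _] := gP k.+1.
  have [NN|NN] := leqP (N_ k) (N_ k.+1).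
    by apply: (lt_le_trans aN); apply: a_le; apply: C_mid => //; exact: C_dec CN'.
  apply: (@le_lt_trans _ _ (s - e k.+1)); first by rewrite lerD2l lerN2.
  apply: (lt_le_trans aN'); apply: a_le; apply: C_mid => //.
  by apply: C_dec CN; exact: ltnW.
have Imid k : Q.-integrable setT
    (EFin \o (fun x => (g_ k x + g_ k.+1 x) / 2 * ((g_ k x + g_ k.+1 x) / 2))).
  apply: (isq k); apply: C_mid; first exact: Cg.
  by apply: C_dec (Cg k.+1); exact: leqnSn.
have Id k : Q.-integrable setT
    (EFin \o (fun x => `|g_ k.+1 x - g_ k x|)).
  apply: (@bounded_integrable _ _ _ _ _ 1).
    by apply: measurableT_comp => //; apply: measurable_funB; case: (tg k); case: (tg k.+1).
  move=> x; rewrite normr_id; have [_ /(_ x)] := tg k; have [_ /(_ x)] := tg k.+1.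
  by rewrite ler_norml; lra.
have bound k : \int[Q]_x `|g_ k.+1 x - g_ k x| <= 5 * 2^-1 ^+ k.
  (* This weight is the inverse square root of [e k]. The parallelogram identity bounds the integral
     of the squared increment by [8 * e k], that is 8 / b^2; AM-GM with weight [b] then gives 4.5 /
     b, rounded up to 5 / b. *)
  pose b : R := 2 ^+ k.
  have b_gt0 : 0 < b by rewrite exprn_gt0.
  have eb : e k = b^-1 * b^-1 by rewrite -invfM -exprMn -natrM /e exprVn.
  have -> : 2^-1 ^+ k = b^-1 by rewrite exprVn.
  have Ic : Q.-integrable setT (EFin \o cst (b^-1 / 2)).
    exact: finite_measure_integrable_cst.
  pose F x := b * (g_ k x * g_ k x) + b * (g_ k.+1 x * g_ k.+1 x).
  pose G x := (2 * b) * ((g_ k x + g_ k.+1 x) / 2 * ((g_ k x + g_ k.+1 x) / 2)).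
  have Ik := isq _ _ (Cg k); have Ik1 := isq _ _ (Cg k.+1).
  have I1 : Q.-integrable setT (EFin \o (fun x => b * (g_ k x * g_ k x))).
    exact: (integrableZl measurableT b Ik).
  have I2 : Q.-integrable setT (EFin \o (fun x => b * (g_ k.+1 x * g_ k.+1 x))).
    exact: (integrableZl measurableT b Ik1).
  have IF : Q.-integrable setT (EFin \o F) by exact: (integrableD measurableT I1 I2).
  have IG : Q.-integrable setT (EFin \o G).
    exact: (integrableZl measurableT (2 * b) (Imid k)).
  have IFG : Q.-integrable setT (EFin \o (fun x => F x - G x)).
    exact: (integrableB measurableT IF IG).
  (* AM-GM: [|d| <= (b d^2 + 1/b) / 2]. *)
  apply: (@le_trans _ _ (\int[Q]_x ((F x - G x) + cst (b^-1 / 2) x))).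
    apply: le_Rintegral => //; first exact: (integrableD measurableT IFG Ic).
    move=> x _; rewrite /F /G /=.
    set u := g_ k x; set v := g_ k.+1 x.
    have -> : b * (u * u) + b * (v * v) - 2 * b * ((u + v) / 2 * ((u + v) / 2)) +
        b^-1 / 2 = (b * `|v - u| ^+ 2 + b^-1) / 2.
      by rewrite real_normK ?num_real//; field; rewrite gt_eqF.
    have := sqr_ge0 (b * `|v - u| - 1); set w := `|v - u| => h.
    suff : 0 <= b * ((b * w ^+ 2 + b^-1) / 2 - w) by rewrite pmulr_rge0// subr_ge0.
    have -> : b * ((b * w ^+ 2 + b^-1) / 2 - w) = (b * w - 1) ^+ 2 / 2.
      by field; rewrite gt_eqF.
    by rewrite divr_ge0.
  have EF : \int[Q]_x F x = b * N2 (g_ k) + b * N2 (g_ k.+1).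
    by rewrite RintegralD// !RintegralZl.
  have EG : \int[Q]_x G x = 2 * b * N2 (fun x => (g_ k x + g_ k.+1 x) / 2).
    by rewrite RintegralZl//; exact: Imid.
  have Ecst : \int[Q]_x cst (b^-1 / 2) x = b^-1 / 2.
    by rewrite Rintegral_cst// [X in fine X]probability_setT mulr1.
  rewrite RintegralD// RintegralB// EF EG Ecst.
  have := mid k; have [_ _ _] := gP k; have [_ _ _] := gP k.+1.
  set n1 := N2 (g_ k); set n2 := N2 (g_ k.+1); set n3 := N2 _.
  have := e_dec k; rewrite eb => ed h2 h1 h3.
  have bb : b * (b^-1 * b^-1) = b^-1 by rewrite mulrA divff ?mul1r// gt_eqF.
  have : b * (n1 + n2 - 2 * n3) <= b * (4 * (b^-1 * b^-1)).
    by apply: ler_wpM2l; [exact: ltW|lra].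
  have b1 : 0 < b^-1 by rewrite invr_gt0.
  rewrite [X in _ <= X]mulrCA bb; lra.
have cv := summable_increments_ae_cvg (fun n => (tg n).1) (fun n => (tg n).2)
  (ler0n _ 5) bound.
(* Convergence holds only almost everywhere. The upper limit is measurable regardless, the clamp
   puts its values in [0, 1] everywhere, and both agree with the limit where it exists. *)
pose g x := Num.min 1 (Num.max 0 (limn_sup (g_ ^~ x))).
exists g_, g.
  split.
    apply: measurable_minr => //; apply: measurable_maxr => //.
    apply: measurable_fun_limn_sup.
    - by move=> x _; exists 1 => _ [n _ <-]; have [_ /(_ x)/andP[]] := tg n.
    - by move=> x _; exists 0 => _ [n _ <-]; have [_ /(_ x)/andP[]] := tg n.
    - by move=> n; case: (tg n).
  by move=> x; rewrite /g le_min ler01 le_max lexx/= ge_min lexx.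
split => //; apply: filterS cv => x cvx.
have -> : g x = limn (g_ ^~ x).
  rewrite /g cvg_limn_supE//.
  rewrite max_r; last first.
    by apply: limr_ge => //; apply: nearW => n; have [_ /(_ x)/andP[]] := tg n.
  rewrite min_r//.
  by apply: limr_le => //; apply: nearW => n; have [_ /(_ x)/andP[]] := tg n.
exact: cvx.
Qed.

End minimal_norm.

(** * Realising a vector that no linear functional separates from the moments *)

Section moments.
Context {d : measure_display} {T : measurableType d} {R : realType}.
Variables (Q : probability T R) (I : finType).
Variables (A : set (T -> R)) (h : I -> T -> R) (M : R) (m : I -> R).
Hypothesis A_test : forall phi, A phi -> test_function phi.
Hypothesis A_convex : forall phi psi s, 0 <= s <= 1 -> A phi -> A psi ->
  A (fun x => (1 - s) * phi x + s * psi x).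
Hypothesis mh : forall i, measurable_fun setT (h i).
Hypothesis hM : forall i x, `|h i x| <= M.

(* Minimise the distance from [m] to the moments of members of [A]; at the
   minimiser the direction towards [m] would be a separating one. *)
Lemma unseparated_moments :
  (forall (v : I -> R) (e : R), 0 < e -> exists2 phi, A phi &
     \sum_i v i * \int[Q]_x (phi x * h i x) <= \sum_i v i * m i + e) ->
  exists g_ : nat -> T -> R, exists2 g, test_function g &
    [/\ forall n, A (g_ n),
        forall i, \int[Q]_x (g_ n x * h i x) @[n --> \oo] --> m i &
        forall i, \int[Q]_x (g x * h i x) = m i].
Proof.
move=> unsep.
pose mo (phi : T -> R) i := \int[Q]_x (phi x * h i x).
have Imo phi i : test_function phi ->
    Q.-integrable setT (EFin \o (fun x => phi x * h i x)).
  by move=> tphi; exact: test_integrable (mh i) (hM i).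
have mo_comb phi psi s i : test_function phi -> test_function psi ->
    mo (fun x => (1 - s) * phi x + s * psi x) i = (1 - s) * mo phi i + s * mo psi i.
  move=> tphi tpsi; rewrite /mo -!RintegralZl//; try exact: Imo.
  rewrite -RintegralD//.
  - by apply: eq_Rintegral => x _; ring.
  - exact: (integrableZl measurableT (1 - s) (Imo _ i tphi)).
  - exact: (integrableZl measurableT s (Imo _ i tpsi)).
pose J phi := \sum_i (mo phi i - m i) ^+ 2.
have J_ge0 phi : 0 <= J phi by apply: sumr_ge0 => i _; exact: sqr_ge0.
pose S := [set J phi | phi in A]; pose delta := inf S.
have A_ne : exists phi, A phi.
  by have [phi Aphi _] := unsep (fun=> 0) 1 ltr01; exists phi.
have lbS : has_lbound S by exists 0 => _ [phi _ <-].
have infS : has_inf S by split => //; have [phi Aphi] := A_ne; exists (J phi), phi.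
have delta_le phi : A phi -> delta <= J phi by move=> Aphi; apply: ge_inf => //; exists phi.
(* These sublevel sets are nested, nonempty since [delta] is an infimum, and midpoint-convex because
   [J] is a convex function of moments that are affine in [phi]. *)
pose C n := [set phi | A phi /\ J phi <= delta + n.+1%:R^-1].
have [g_ [g tg [Cg cg]]] : exists g_ : nat -> T -> R, exists2 g, test_function g &
    (forall n, C n (g_ n)) /\ {ae Q, forall x, g_ ^~ x @ \oo --> g x}.
  apply: midconvex_ae_limit.
  - move=> k n kn phi [Aphi Jphi]; split => //; apply: (le_trans Jphi).
    by rewrite lerD2l lef_pV2 ?posrE ?ltr0n// ler_nat ltnS.
  - move=> n; have n0 : 0 < n.+1%:R^-1 :> R by rewrite invr_gt0 ltr0n.
    by have [_ [phi Aphi <-] Jphi] := inf_adherent n0 infS; exists phi; split => //; exact: ltW.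
  - by move=> n phi [Aphi _]; exact: A_test.
  - move=> n phi psi [Aphi Jphi] [Apsi Jpsi].
    have -> : (fun x => (phi x + psi x) / 2) = (fun x => (1 - 2^-1) * phi x + 2^-1 * psi x).
      by apply/funext => x; field.
    split; first by apply: A_convex => //; rewrite invr_ge0 ler0n/= invf_le1// ler1n.
    apply: (@le_trans _ _ ((J phi + J psi) / 2)); last first.
      by move: Jphi Jpsi; move: (J phi) (J psi) (delta + _) => a b c; lra.
    rewrite /J -big_split/= mulr_suml; apply: ler_sum => i _.
    rewrite mo_comb; [|exact: A_test..].
    set u := mo phi i; set v := mo psi i.
    have -> : ((1 - 2^-1) * u + 2^-1 * v - m i) ^+ 2 =
        ((u - m i) ^+ 2 + (v - m i) ^+ 2) / 2 - (u - v) ^+ 2 / 4 by field.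
    by rewrite gerBl divr_ge0 ?sqr_ge0.
have Ag n : A (g_ n) by have [] := Cg n.
pose u i := mo g i.
have cu i : mo (g_ n) i @[n --> \oo] --> u i.
  apply: (@cvg_Rintegral_bounded _ _ _ _ _ _ M).
  - by move=> n; apply: measurable_funM => //; case: (A_test (Ag n)).
  - by apply: measurable_funM => //; case: tg.
  - by apply: filterS cg => x gx; apply: cvgM => //; exact: cvg_cst.
  - by move=> n x; apply: test_function_mul_le => //; exact: A_test.
have cvg_sq (w_ : nat -> I -> R) (w : I -> R) :
    (forall i, w_ n i @[n --> \oo] --> w i) ->
    \sum_i (w_ n i - m i) ^+ 2 @[n --> \oo] --> \sum_i (w i - m i) ^+ 2.
  move=> cw; apply: cvg_sumr => i.
  by apply: cvgM; apply: cvgB => //; exact: cvg_cst.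
have Ju : \sum_i (u i - m i) ^+ 2 <= delta.
  apply: (ler_cvg_to (cvg_sq _ _ cu) (_ : delta + n.+1%:R^-1 @[n --> \oo] --> delta)).
    rewrite -[X in _ --> X]addr0; apply: cvgD; first exact: cvg_cst.
    exact: cvg_harmonic.
  by apply: nearW => n; have [] := Cg n.
pose v i := u i - m i.
have opt phi : A phi -> \sum_i v i * u i <= \sum_i v i * mo phi i.
  move=> Aphi.
  (* The limit [g] may lie outside [A], so the inequality is proved for mixtures of [g_ n] with
     [phi] and passed to the limit in the moments. *)
  have quad s : 0 <= s <= 1 -> delta <= \sum_i ((1 - s) * u i + s * mo phi i - m i) ^+ 2.
    move=> s01.
    have cs i : (1 - s) * mo (g_ n) i + s * mo phi i @[n --> \oo] -->
        (1 - s) * u i + s * mo phi i.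
      by apply: cvgD; [apply: cvgM => //|]; exact: cvg_cst.
    apply: (cvgr_to_ge (cvg_sq _ _ cs)); apply: nearW => n.
    have := delta_le _ (A_convex s01 (Ag n) Aphi); congr (_ <= _).
    by apply: eq_bigr => i _; rewrite mo_comb//; exact: A_test.
  pose w i := mo phi i - u i.
  have {}quad s : 0 < s <= 1 -> 0 <= 2 * (\sum_i v i * w i) + s * \sum_i w i ^+ 2.
    move=> /andP[s0 s1]; have := quad s; rewrite (ltW s0) s1 => /(_ isT) qs.
    have := le_trans Ju qs; rewrite -subr_ge0 -sumrB.
    have -> : \sum_i (((1 - s) * u i + s * mo phi i - m i) ^+ 2 - (u i - m i) ^+ 2) =
        s * (2 * (\sum_i v i * w i) + s * \sum_i w i ^+ 2).
      rewrite !mulr_sumr -big_split/= mulr_sumr; apply: eq_bigr => i _.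
      by rewrite /v /w; ring.
    by rewrite pmulr_rge0.
  have : 0 <= \sum_i v i * w i.
    set a := \sum_i v i * w i; set b := \sum_i w i ^+ 2.
    have b0 : 0 <= b by apply: sumr_ge0 => i _; exact: sqr_ge0.
    rewrite leNgt; apply/negP => a0.
    have ab : 0 < b - a by rewrite subr_gt0 (lt_le_trans a0).
    (* If [a < 0], the step [- a / (b - a)] lies in (0, 1] and gives the first-order expansion
       [2 * a + s * b] the value [a + a * s], which is negative. *)
    have sb : - a / (b - a) * b = - a + a * (- a / (b - a)).
      by field; rewrite gt_eqF.
    have sP : 0 < - a / (b - a) by rewrite divr_gt0// oppr_gt0.
    have := quad (- a / (b - a)); rewrite -/a -/b sP sb ler_pdivrMr// mul1r.
    have -> : - a <= b - a by rewrite lerDr.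
    move=> /(_ isT); have : a * (- a / (b - a)) < 0 by rewrite nmulr_rlt0.
    by lra.
  have -> : \sum_i v i * w i = \sum_i v i * mo phi i - \sum_i v i * u i.
    by rewrite -sumrB; apply: eq_bigr => i _; rewrite /w mulrBr.
  by rewrite subr_ge0.
(* With [v] equal to [u - m], optimality and the absence of separation bound the sum of the
   [v i * (u i - m i)], which is the squared distance itself, by every [e > 0]. *)
have delta0 : delta <= 0.
  apply/ler_addgt0Pr => e e0; rewrite add0r.
  have [phi Aphi le_e] := unsep v e e0.
  have := le_trans (opt _ Aphi) le_e; rewrite -lerBlDl -sumrB.
  apply: le_trans.
  have -> : \sum_i (v i * u i - v i * m i) = \sum_i (u i - m i) ^+ 2.
    by apply: eq_bigr => i _; rewrite /v; ring.
  exact: (cvgr_to_ge (cvg_sq _ _ cu) (nearW _ (fun n => delta_le _ (Ag n)))).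
have um i : u i = m i.
  have : \sum_i (u i - m i) ^+ 2 == 0.
    by rewrite eq_le (le_trans Ju)//= sumr_ge0// => j _; exact: sqr_ge0.
  rewrite psumr_eq0; last by move=> j _; exact: sqr_ge0.
  by move=> /allP/(_ i); rewrite mem_index_enum sqrf_eq0 subr_eq0 => /(_ isT)/eqP.
exists g_, g => //; split => // i; rewrite -um; exact: cu.
Qed.

End moments.

(** * Continuity, entrywise convergence of matrices, and extraction of subsequences *)

Lemma continuous_mulr (R : realType) (T : topologicalType) (f g : T -> R) :
  continuous f -> continuous g -> continuous (fun x => f x * g x).
Proof. by move=> cf cg x; apply: cvgM; [exact: cf|exact: cg]. Qed.

Lemma continuous_addr (R : realType) (T : topologicalType) (f g : T -> R) :
  continuous f -> continuous g -> continuous (fun x => f x + g x).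
Proof. by move=> cf cg x; apply: cvgD; [exact: cf|exact: cg]. Qed.

Lemma continuous_sumr (R : realType) (T : topologicalType) (I : finType)
    (f : I -> T -> R) :
  (forall i, continuous (f i)) -> continuous (fun x => \sum_i f i x).
Proof. by move=> cf x; apply: cvg_sumr => i; exact: cf. Qed.

Lemma continuous_clamp (R : realType) (T : topologicalType) (f : T -> R) :
  continuous f -> continuous (fun x => Num.max 0 (Num.min 1 (f x))).
Proof.
move=> cf x; apply: (@continuous_max R T (cst 0) (fun x => Num.min 1 (f x)) x).
  exact: cst_continuous.
apply: (@continuous_min R T (cst 1) f x); [exact: cst_continuous|exact: cf].
Qed.

Lemma cvg_mx_entries (R : realType) (m n : nat) (U : Type) (F : set_system U)
    (M_ : U -> 'M[R]_(m, n)) (M : 'M[R]_(m, n)) : Filter F ->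
  (forall i j, M_ x i j @[x --> F] --> M i j) -> M_ x @[x --> F] --> M.
Proof.
move=> FF cM; apply/cvg_ballP => e e0.
have : \forall x \near F, forall ij : 'I_m * 'I_n, ball (M ij.1 ij.2) e (M_ x ij.1 ij.2).
  apply: filter_forall => -[i j] /=; exact: (cvg_ballP _ _).1 (cM i j) e e0.
by apply: filterS => x Mx; split => // i j; exact: Mx (i, j).
Qed.

Lemma cvg_det (R : realType) (n : nat) (U : Type) (F : set_system U)
    (M_ : U -> 'M[R]_n) (M : 'M[R]_n) : Filter F ->
  (forall i j, M_ x i j @[x --> F] --> M i j) ->
  \det (M_ x) @[x --> F] --> \det M.
Proof.
move=> FF cM; rewrite /determinant; apply: cvg_sumr => s.
by apply: cvgM; [exact: cvg_cst|apply: cvg_prodr => i; exact: cM].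
Qed.

Lemma increasing_seq_cvgy (f : nat -> nat) : increasing_seq f -> f @ \oo --> \oo.
Proof.
move=> incf; apply/cvgnyPge => N; near=> n.
have fn p : (p <= f p)%N.
  elim: p => // p IH; apply: (leq_ltn_trans IH).
  by move/increasing_seqP : incf; exact.
apply: leq_trans (fn n); near: n; exact: nbhs_infty_ge.
Unshelve. all: by end_near. Qed.

Lemma increasing_seq_comp (f g : nat -> nat) :
  increasing_seq f -> increasing_seq g -> increasing_seq (f \o g).
Proof. by move=> incf incg n m /=; rewrite incf -leEnat incg. Qed.

(** Extraction proceeds one index at a time; limits already secured survive further extraction. *)
Lemma bolzano_weierstrass_family (R : realType) (I : finType)
    (u : nat -> I -> R) (B : R) : (forall n i, `|u n i| <= B) ->
  exists2 f : nat -> nat, increasing_seq f & forall i, cvgn (fun n => u (f n) i).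
Proof.
move=> uB.
suff [f incf cf] : exists2 f : nat -> nat, increasing_seq f &
    forall i, i \in enum I -> cvgn (fun n => u (f n) i).
  by exists f => // i; apply: cf; rewrite mem_enum.
elim: (enum I) => [|i s [f incf cf]]; first by exists id.
have [|g incg cg] := @bolzano_weierstrass R (fun n => u (f n) i).
  by exists B; split; [exact: num_real|move=> M BM n _ /=; rewrite (le_trans (uB _ _))// ltW].
exists (f \o g); first exact: increasing_seq_comp.
move=> j; rewrite inE => /predU1P[->|js]; first exact: cg.
have /cvg_ex[l cl] := cf _ js; apply/cvg_ex; exists l.
exact: (cvg_comp _ _ (increasing_seq_cvgy incg) cl).
Qed.

(** * Quadratic monomials and continuous functions of bounded support *)

Section column_vectors.
Context {R : realType} {k : nat}.
Implicit Types (f g phi : 'cV[R]_k -> R) (P : probability 'cV[R]_k R).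

Lemma continuous_cV_measurable f : continuous f -> measurable_fun setT f.
Proof.
move=> /continuousP cf; apply: (measurability _ (RGenOpens.measurableE R)).
move=> _ [_ [a [b ->] <-]]; rewrite setTI; apply: sub_sigma_algebra.
exact/cf/interval_open.
Qed.

(* The coordinates of the augmented vector (1, x). *)
Definition aug (x : 'cV[R]_k) (a : option 'I_k) : R :=
  if a is Some i then x i 0 else 1.

(** These are the monomials of degree at most two, the constant 1 sitting at [(None, None)]. One
    finite family thus carries mass, first and second moments. *)
Definition quad (ab : option 'I_k * option 'I_k) (x : 'cV[R]_k) : R :=
  aug x ab.1 * aug x ab.2.

Lemma continuous_quad ab : continuous (quad ab).
Proof.
have ca a : continuous (aug^~ a).
  by case: a => [i|]; [exact: coord_continuous|exact: cst_continuous].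
by apply: continuous_mulr; exact: ca.
Qed.

Lemma aug_norm x a B : 1 <= B -> `|x| <= B -> `|aug x a| <= B.
Proof.
case: a => [i|] B1 xB /=; last by rewrite normr1.
apply: le_trans xB; rewrite [leRHS]/Num.norm/= mx_normrE.
by apply: (le_trans _ (le_bigmax _ _ (i, 0))).
Qed.

Lemma quad_norm x ab B : 1 <= B -> `|x| <= B -> `|quad ab x| <= B ^+ 2.
Proof.
by move=> B1 xB; rewrite normrM expr2 ler_pM//; exact: aug_norm.
Qed.

Lemma enorm_sqr (x : 'cV[R]_k) : enorm x ^+ 2 = \sum_i quad (Some i, Some i) x.
Proof.
rewrite sqr_sqrtr; last by apply: sumr_ge0 => i _; exact: sqr_ge0.
by apply: eq_bigr => i _; rewrite expr2.
Qed.

(** By AM-GM. Through this bound the finite second moment required in [trimmingK] makes all the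
    moments integrable. *)
Lemma quad_le_enorm ab x : `|quad ab x| <= 1 + enorm x ^+ 2.
Proof.
have sa a : aug x a ^+ 2 <= 1 + enorm x ^+ 2.
  case: a => [i|] /=; last by rewrite expr1n lerDl sqr_ge0.
  rewrite ler_wpDl// enorm_sqr (bigD1 i)//= /quad/= -expr2 lerDl.
  by apply: sumr_ge0 => j _; rewrite -expr2 sqr_ge0.
have := sa ab.1; have := sa ab.2; have := sqr_ge0 (`|aug x ab.1| - `|aug x ab.2|).
rewrite /quad normrM -(real_normK (num_real (aug x ab.1))).
by rewrite -(real_normK (num_real (aug x ab.2))) !expr2; nra.
Qed.

(** Continuous, equal to 1 on the sup-norm ball of radius [N] and to 0 outside radius [N + 1]. The
    Euclidean ball of radius [N] lies inside the former, by [norm_le_enorm]. *)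
Definition cutoff (N : R) (x : 'cV[R]_k) : R := Num.max 0 (Num.min 1 (N + 1 - `|x|)).

Lemma continuous_cutoff N : continuous (cutoff N).
Proof.
apply: continuous_clamp; apply: continuous_addr; first exact: cst_continuous.
by move=> x; apply: continuousN; exact: norm_continuous.
Qed.

Lemma cutoff_test N : test_function (cutoff N).
Proof.
split; first by apply: continuous_cV_measurable; exact: continuous_cutoff.
by move=> x; rewrite /cutoff le_max lexx ge_max ler01 ge_min lexx.
Qed.

Lemma cutoff1 N x : `|x| <= N -> cutoff N x = 1.
Proof.
move=> xN; have xN1 : 1 <= N + 1 - `|x| by lra.
by rewrite /cutoff (min_l xN1) max_r.
Qed.

Lemma cutoff0 N x : N + 1 <= `|x| -> cutoff N x = 0.
Proof. by move=> xN; rewrite /cutoff max_l// ge_min subr_le0 xN orbT. Qed.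

Lemma norm_le_enorm (x : 'cV[R]_k) : `|x| <= enorm x.
Proof.
rewrite [leLHS]/Num.norm/= mx_normrE; apply/bigmax_leP; split; first exact: sqrtr_ge0.
move=> [i j] _ /=; rewrite (ord1 j) -sqrtr_sqr ler_sqrt.
  by rewrite (bigD1 i)//= lerDl sumr_ge0// => l _; exact: sqr_ge0.
by apply: sumr_ge0 => l _; exact: sqr_ge0.
Qed.

Definition bounded_support f := exists B, forall x, B < `|x| -> f x = 0.

(** The product of such a function with any [quad ab] is bounded and continuous, so its moments
    converge under [weak_cvg]. *)
Definition bump f :=
  [/\ continuous f, forall x, 0 <= f x <= 1 & bounded_support f].

Lemma bump_test f : bump f -> test_function f.
Proof. by case=> cf f01 _; split => //; exact: continuous_cV_measurable. Qed.

Lemma supported_quad_bounded f : (forall x, 0 <= f x <= 1) -> bounded_support f ->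
  exists B, forall ab x, `|f x * quad ab x| <= B.
Proof.
move=> f01 [B fB]; exists (Num.max 1 B ^+ 2) => ab x.
have [xB|Bx] := leP `|x| B; last by rewrite fB// mul0r normr0 sqr_ge0.
have qB : `|quad ab x| <= Num.max 1 B ^+ 2.
  by apply: quad_norm; rewrite le_max ?lexx// xB orbT.
apply: le_trans qB; rewrite normrM ler_piMl//.
by have := f01 x; rewrite ler_norml; lra.
Qed.

Lemma bump_cutoff N : bump (cutoff N).
Proof.
split; [exact: continuous_cutoff|by case: (cutoff_test N)|].
by exists (N + 1) => x /ltW; exact: cutoff0.
Qed.

Lemma bump_mul f g : continuous f -> (forall x, 0 <= f x <= 1) -> bump g ->
  bump (fun x => f x * g x).
Proof.
move=> cf f01 [cg g01 [B gB]]; split.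
- exact: continuous_mulr.
- by move=> x; have := f01 x; have := g01 x; nra.
- by exists B => x /gB ->; rewrite mulr0.
Qed.

Lemma bump_convex f g s : 0 <= s <= 1 -> bump f -> bump g ->
  bump (fun x => (1 - s) * f x + s * g x).
Proof.
move=> s01 [cf f01 [B fB]] [cg g01 [B' gB']]; split.
- by apply: continuous_addr; apply: continuous_mulr => //; exact: cst_continuous.
- by move=> x; have := f01 x; have := g01 x; nra.
- by exists (Num.max B B') => x; rewrite gt_max => /andP[/fB -> /gB' ->]; rewrite !mulr0 addr0.
Qed.

End column_vectors.

(** * Mean and covariance as functions of moments, and moments under weak limits *)

Section trimmed_moments.
Context {R : realType} {k : nat}.
Implicit Types (f g phi : 'cV[R]_k -> R) (P Q : probability 'cV[R]_k R).
Implicit Types (gamma : R).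

Definition moment P phi (ab : option 'I_k * option 'I_k) : R :=
  \int[P]_x (phi x * quad ab x).

Definition quad_integrable P phi := forall ab : option 'I_k * option 'I_k,
  P.-integrable setT (EFin \o (fun x => phi x * quad ab x)).

Lemma measurable_quad (ab : option 'I_k * option 'I_k) :
  measurable_fun setT (@quad R k ab).
Proof. by apply: continuous_cV_measurable; exact: continuous_quad. Qed.

Lemma moment_mass P phi : moment P phi (None, None) = \int[P]_x phi x.
Proof. by apply: eq_Rintegral => x _; rewrite /quad/= !mulr1. Qed.

Lemma quad_integrable_mass P phi : quad_integrable P phi ->
  P.-integrable setT (EFin \o phi).
Proof.
move=> /(_ (None, None)); apply: eq_integrable => // x _.
by rewrite /= /quad/= !mulr1.
Qed.

Lemma trimmingK_test P gamma phi : trimmingK P gamma phi -> test_function phi.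
Proof. by case. Qed.

Lemma trimmingK_quad_integrable P gamma phi :
  trimmingK P gamma phi -> quad_integrable P phi.
Proof.
move=> [mphi phi01 _ fin2] ab.
have menorm : measurable_fun setT (fun x : 'cV[R]_k => enorm x ^+ 2).
  apply: (@eq_measurable_fun _ _ _ _ setT
    (fun x : 'cV[R]_k => \sum_i quad (Some i, Some i) x)).
    by move=> x _; rewrite enorm_sqr.
  apply: continuous_cV_measurable; apply: continuous_sumr => i.
  exact: continuous_quad.
have I2 : P.-integrable setT (EFin \o (fun x => enorm x ^+ 2 * phi x)).
  apply/integrableP; split; first by apply/measurable_EFinP; exact: measurable_funM.
  under eq_integral => x _.
    rewrite gee0_abs; last first.
      by rewrite lee_fin mulr_ge0 ?sqr_ge0//; have /andP[] := phi01 x.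
    over.
  exact: fin2.
have I1 : P.-integrable setT (EFin \o phi).
  apply: (@bounded_integrable _ _ _ _ _ 1) => // x.
  by have := phi01 x; rewrite ler_norml; lra.
apply: (@le_integrable _ _ _ P _ measurableT _
  (EFin \o (fun x => phi x + enorm x ^+ 2 * phi x))).
- by apply/measurable_EFinP; apply: measurable_funM => //; exact: measurable_quad.
- move=> x _; rewrite /= lee_fin normrM.
  have /andP[p0 _] := phi01 x.
  rewrite (ger0_norm p0) [leRHS]ger0_norm; last first.
    by rewrite addr_ge0// mulr_ge0// sqr_ge0.
  have := quad_le_enorm ab x; rewrite -[X in _ -> _ <= X + _]mul1r -mulrDl mulrC => h.
  exact: ler_wpM2r.
- exact: (integrableD measurableT I1 I2).
Qed.

Definition mean_of (M : option 'I_k * option 'I_k -> R) : 'cV[R]_k :=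
  \col_i ((M (None, None))^-1 * M (None, Some i)).

(** The uncentred form of the covariance, E[XX'] - E[X]E[X]', divides only by the mass and is
    therefore continuous wherever the mass is nonzero. *)
Definition cov_of (M : option 'I_k * option 'I_k -> R) : 'M[R]_k :=
  \matrix_(i, j) ((M (None, None))^-1 * M (Some i, Some j) -
                  mean_of M i 0 * mean_of M j 0).

Lemma trimmed_mean_moment P phi : trimmed_mean P phi = mean_of (moment P phi).
Proof.
apply/colP => i; rewrite !mxE moment_mass; congr (_ * _).
by apply: eq_Rintegral => x _; rewrite /quad/= mul1r mulrC.
Qed.

Lemma trimmed_cov_moment P phi : quad_integrable P phi ->
  \int[P]_x phi x != 0 -> trimmed_cov P phi = cov_of (moment P phi).
Proof.
move=> Iphi phi_neq0; apply/matrixP => i j; rewrite /trimmed_cov trimmed_mean_moment.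
set T := mean_of _.
have Ti l : moment P phi (None, Some l) = T l 0 * moment P phi (None, None).
  by rewrite mxE mulrAC mulVf ?mul1r// moment_mass.
rewrite !mxE -/T -moment_mass.
have -> : \int[P]_x (((x - T) *m (x - T)^T) i j * phi x) =
    moment P phi (Some i, Some j) - T i 0 * moment P phi (None, Some j)
    - T j 0 * moment P phi (None, Some i) + T i 0 * T j 0 * moment P phi (None, None).
  have IZ c ab : P.-integrable setT (EFin \o (fun x => c * (phi x * quad ab x))).
    exact: (integrableZl measurableT c (Iphi ab)).
  have EZ c ab : \int[P]_x (c * (phi x * quad ab x)) = c * moment P phi ab.
    exact: RintegralZl.
  rewrite -!EZ -(RintegralB measurableT (Iphi _) (IZ _ _)).
  have I1 : P.-integrable setT (EFin \o (fun x =>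
      phi x * quad (Some i, Some j) x - T i 0 * (phi x * quad (None, Some j) x))).
    exact: (integrableB measurableT (Iphi _) (IZ _ _)).
  rewrite -(RintegralB measurableT I1 (IZ _ _)).
  have I2 : P.-integrable setT (EFin \o (fun x =>
      phi x * quad (Some i, Some j) x - T i 0 * (phi x * quad (None, Some j) x)
      - T j 0 * (phi x * quad (None, Some i) x))).
    exact: (integrableB measurableT I1 (IZ _ _)).
  rewrite -(RintegralD measurableT I2 (IZ _ _)).
  apply: eq_Rintegral => x _; rewrite mxE big_ord_recl big_ord0 addr0 !mxE /quad/=.
  by ring.
have m0 : moment P phi (None, None) != 0 by rewrite moment_mass.
rewrite !Ti; move: (T i 0) (T j 0) (moment P phi (None, None)) m0 => a b c c0.
by field.
Qed.

Lemma cvg_mean_of (U : Type) (F : set_system U)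
    (M_ : U -> option 'I_k * option 'I_k -> R) M : Filter F ->
  (forall ab, M_ n ab @[n --> F] --> M ab) -> M (None, None) != 0 ->
  forall i j, mean_of (M_ n) i j @[n --> F] --> mean_of M i j.
Proof.
move=> FF cM M0 i j; rewrite mxE.
under eq_cvg do rewrite mxE.
by apply: cvgM => //; exact: cvgV.
Qed.

Lemma cvg_cov_of (U : Type) (F : set_system U)
    (M_ : U -> option 'I_k * option 'I_k -> R) M : Filter F ->
  (forall ab, M_ n ab @[n --> F] --> M ab) -> M (None, None) != 0 ->
  forall i j, cov_of (M_ n) i j @[n --> F] --> cov_of M i j.
Proof.
move=> FF cM M0 i j; rewrite mxE.
under eq_cvg do rewrite mxE.
by apply: cvgB; apply: cvgM => //; [exact: cvgV|exact: cvg_mean_of..].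
Qed.

Lemma test_bounded_quad_integrable P f : test_function f ->
  (exists B, forall ab x, `|f x * quad ab x| <= B) -> quad_integrable P f.
Proof.
move=> [mf _] [B fB] ab; apply: (@bounded_integrable _ _ _ _ _ B) => //.
by apply: measurable_funM => //; exact: measurable_quad.
Qed.

Lemma supported_trimmingK P gamma f : test_function f -> bounded_support f ->
  gamma <= \int[P]_x f x -> trimmingK P gamma f.
Proof.
move=> tf sf gf; have [mf f01] := tf.
have If : quad_integrable P f.
  by apply: test_bounded_quad_integrable => //; exact: supported_quad_bounded.
split => //.
  have -> : (\int[P]_x (f x)%:E = (\int[P]_x f x)%:E)%E.
    rewrite /Rintegral fineK//.
    exact: integrable_fin_num (quad_integrable_mass If).
  by rewrite lee_fin.
have -> : (fun x => (enorm x ^+ 2 * f x)%:E) =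
    (fun x => \sum_(i < k) (f x * quad (Some i, Some i) x)%:E)%E.
  by apply/funext => x; rewrite sumEFin -mulr_sumr -enorm_sqr mulrC.
by apply: integrable_lty => //; apply: integrable_sum => // i _; exact: If.
Qed.

Lemma weak_cvg_moment (P_ : nat -> probability 'cV[R]_k R) Q f : weak_cvg P_ Q ->
  bump f -> forall ab, moment (P_ n) f ab @[n --> \oo] --> moment Q f ab.
Proof.
move=> PQ [cf f01 sf] ab; apply: PQ.
  by apply: continuous_mulr => //; exact: continuous_quad.
by have [B fB] := supported_quad_bounded f01 sf; exists B.
Qed.

(* The clamped multiple of [- L] nearly minimises [\int phi L] over all test
   functions [phi], for every measure at once. *)
Lemma clamp_minimizes (c s l : R) : 0 < c -> 0 <= s <= 1 ->
  Num.max 0 (Num.min 1 (- c^-1 * l)) * l <= s * l + c.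
Proof.
move=> c0 /andP[s0 s1].
have [l0|l0] := leP 0 l.
  have min_le0 : Num.min 1 (- c^-1 * l) <= 0.
    by rewrite ge_min mulNr oppr_le0 mulr_ge0 ?orbT// invr_ge0 ltW.
  by rewrite (max_l min_le0) mul0r addr_ge0 ?mulr_ge0// ltW.
have cl : 0 <= - c^-1 * l by rewrite mulNr -mulrN mulr_ge0 ?invr_ge0 ?oppr_ge0// ltW.
have [h|h] := leP 1 (- c^-1 * l).
  by rewrite max_r ?ler01// mul1r; nra.
rewrite max_r//.
have lc : - l < c by move: h; rewrite mulNr -mulrN mulrC ltr_pdivrMr// mul1r.
apply: (@le_trans _ _ 0); last by nra.
by rewrite mulr_ge0_le0// ltW.
Qed.

(** For a linear functional of the moments, a continuous clamp does almost as well as [psi_ n] under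
    each [P_ n]. This comparison, unlike [psi_] itself, survives the weak limit, so the limit vector
    is not separated from the moments of continuous functions under [Q]. *)
Lemma weak_limit_moments (P_ : nat -> probability 'cV[R]_k R) Q
    (psi_ : nat -> 'cV[R]_k -> R) (N : R) (M : option 'I_k * option 'I_k -> R) :
  weak_cvg P_ Q -> (forall n, test_function (psi_ n)) ->
  (forall ab, moment (P_ n) (fun x => psi_ n x * cutoff N x) ab @[n --> \oo] --> M ab) ->
  exists g_ : nat -> 'cV[R]_k -> R, exists2 g, test_function g &
    [/\ forall n, bump (fun x => g_ n x * cutoff N x),
        forall ab, moment Q (fun x => g_ n x * cutoff N x) ab @[n --> \oo] --> M ab &
        forall ab, moment Q (fun x => g x * cutoff N x) ab = M ab].
Proof.
move=> PQ tpsi cM.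
(* The cutoff is absorbed into the integrands, which become bounded and continuous, leaving the
   class [A] below free of any support condition. *)
pose h ab x := cutoff N x * @quad R k ab x.
have [B hB] : exists B, forall ab x, `|h ab x| <= B.
  by have [_ c01 sc] := @bump_cutoff R k N; exact: supported_quad_bounded.
have ch ab : continuous (h ab).
  by apply: continuous_mulr; [exact: continuous_cutoff|exact: continuous_quad].
have mh ab : measurable_fun setT (h ab) by exact: continuous_cV_measurable.
have momE P f ab : moment P (fun x => f x * cutoff N x) ab = \int[P]_x (f x * h ab x).
  by apply: eq_Rintegral => x _; rewrite /h mulrA.
pose A := [set f : 'cV[R]_k -> R | continuous f /\ forall x, 0 <= f x <= 1].
have A_test f : A f -> test_function f.
  by case=> cf f01; split => //; exact: continuous_cV_measurable.
have A_convex f g s : 0 <= s <= 1 -> A f -> A g ->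
    A (fun x => (1 - s) * f x + s * g x).
  move=> s01 [cf f01] [cg g01]; split.
    by apply: continuous_addr; apply: continuous_mulr => //; exact: cst_continuous.
  by move=> x; have := f01 x; have := g01 x; nra.
have Ih P f ab : test_function f ->
    P.-integrable setT (EFin \o (fun x => f x * h ab x)).
  by move=> tf; exact: test_integrable (mh ab) (hB ab).
have comb P f (v : option 'I_k * option 'I_k -> R) : test_function f ->
    P.-integrable setT (EFin \o (fun x => f x * \sum_ab v ab * h ab x)) /\
    \int[P]_x (f x * \sum_ab v ab * h ab x) = \sum_ab v ab * \int[P]_x (f x * h ab x).
  move=> tf.
  have IZ ab : P.-integrable setT (EFin \o (fun x => v ab * (f x * h ab x))).
    exact: (integrableZl measurableT (v ab) (Ih P f ab tf)).
  have E x : (f x * \sum_ab v ab * h ab x)%:E =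
      (\sum_ab (v ab * (f x * h ab x))%:E)%E.
    by rewrite sumEFin mulr_sumr; congr EFin; apply: eq_bigr => ab _; rewrite mulrCA.
  split.
    have -> : EFin \o (fun x => f x * \sum_ab v ab * h ab x) =
        (fun x => (\sum_ab (v ab * (f x * h ab x))%:E)%E) by apply/funext => x; exact: E.
    by apply: integrable_sum => // ab _; exact: IZ.
  rewrite /Rintegral; under eq_integral do rewrite E.
  rewrite integral_sum//.
  rewrite -sum_fine; last by move=> ab _; exact: integrable_fin_num (IZ ab).
  by apply: eq_bigr => ab _; exact: (RintegralZl (v ab) measurableT (Ih P f ab tf)).
have [v e e0|g_ [g tg [Ag cg Eg]]] :=
  @unseparated_moments _ _ _ Q _ A h B M A_test A_convex mh hB; last first.
  exists g_, g => //; split.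
  - by move=> n; have [cgn g01] := Ag n; apply: bump_mul => //; exact: bump_cutoff.
  - by move=> ab; under eq_cvg do rewrite momE; exact: cg.
  - by move=> ab; rewrite momE.
pose L x := \sum_ab v ab * h ab x.
have cL : continuous L.
  by apply: continuous_sumr => ab; apply: continuous_mulr => //; exact: cst_continuous.
pose f x := Num.max 0 (Num.min 1 (- e^-1 * L x)).
have Af : A f.
  split; last by move=> x; rewrite le_max lexx ge_max ler01 ge_min lexx.
  by apply: continuous_clamp; apply: continuous_mulr => //; exact: cst_continuous.
have tf := A_test _ Af.
exists f => //; have [_ <-] := comb Q f v tf.
have LB x : `|L x| <= \sum_ab `|v ab| * B.
  apply: (le_trans (ler_norm_sum _ _ _)); apply: ler_sum => ab _.
  by rewrite normrM ler_wpM2l.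
have cfL : \int[P_ n]_x (f x * L x) @[n --> \oo] --> \int[Q]_x (f x * L x).
  apply: PQ; first by apply: continuous_mulr => //; case: Af.
  by exists (\sum_ab `|v ab| * B) => x; exact: test_function_mul_le.
have cpsi : \sum_ab v ab * moment (P_ n) (fun x => psi_ n x * cutoff N x) ab + e
    @[n --> \oo] --> \sum_ab v ab * M ab + e.
  apply: cvgD; last exact: cvg_cst.
  by apply: cvg_sumr => ab; apply: cvgM => //; exact: cvg_cst.
apply: (ler_cvg_to cfL cpsi); apply: nearW => n.
under eq_bigr do rewrite momE.
have [IpsiL <-] := comb (P_ n) (psi_ n) v (tpsi n).
have Ie : (P_ n).-integrable setT (EFin \o cst e).
  exact: finite_measure_integrable_cst.
have -> : e = \int[P_ n]_x cst e x.
  by rewrite Rintegral_cst// [X in fine X]probability_setT mulr1.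
rewrite -RintegralD//.
apply: le_Rintegral => //.
- by have [] := comb (P_ n) f v tf.
- exact: (integrableD measurableT IpsiL Ie).
- by move=> x _; apply: clamp_minimizes => //; case: (tpsi n).
Qed.

End trimmed_moments.

(** * Approximation by continuous functions of mass above gamma *)

Section approximation.
Context {R : realType} {k : nat}.
Implicit Types (f g phi : 'cV[R]_k -> R) (P Q : probability 'cV[R]_k R).
Implicit Types (gamma : R).

Lemma trimmingK_mass P gamma phi : trimmingK P gamma phi ->
  gamma <= \int[P]_x phi x.
Proof.
move=> Kphi; have Iphi := quad_integrable_mass (trimmingK_quad_integrable Kphi).
case: Kphi => _ _ + _; rewrite -lee_fin /Rintegral fineK//.
exact: integrable_fin_num Iphi.
Qed.

Lemma norm_Rintegral_le P f B : measurable_fun setT f ->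
  (forall x, `|f x| <= B) -> `|\int[P]_x f x| <= B.
Proof.
move=> mf fB; have If : P.-integrable setT (EFin \o f) by exact: bounded_integrable fB.
apply: (le_trans (le_normr_Rintegral _ If)) => //.
have -> : B = \int[P]_x cst B x.
  by rewrite Rintegral_cst// [X in fine X]probability_setT mulr1.
apply: le_Rintegral => //; first exact: integrable_norm.
exact: finite_measure_integrable_cst.
Qed.

Lemma test_mul f g : test_function f -> test_function g ->
  test_function (fun x => f x * g x).
Proof.
move=> [mf f01] [mg g01]; split; first exact: measurable_funM.
by move=> x; have := f01 x; have := g01 x; nra.
Qed.

Lemma bump_quad_integrable P f : bump f -> quad_integrable P f.
Proof.
move=> bf; apply: test_bounded_quad_integrable; first exact: bump_test.
by case: bf => _ f01 sf; exact: supported_quad_bounded.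
Qed.

Lemma moment_convex P f g s ab : quad_integrable P f -> quad_integrable P g ->
  moment P (fun x => (1 - s) * f x + s * g x) ab =
  (1 - s) * moment P f ab + s * moment P g ab.
Proof.
move=> If Ig; rewrite /moment -!(RintegralZl _ measurableT (If ab)).
rewrite -!(RintegralZl _ measurableT (Ig ab)).
rewrite -(RintegralD measurableT (integrableZl measurableT (1 - s) (If ab))
  (integrableZl measurableT s (Ig ab))).
by apply: eq_Rintegral => x _; ring.
Qed.

Lemma cvg_cutoff (x : 'cV[R]_k) : cutoff n%:R x @[n --> \oo] --> (1 : R).
Proof.
apply: cvg_near_cst; near=> n; apply/eqP; rewrite cutoff1//.
by near: n; exact: nbhs_infty_ger.
Unshelve. all: by end_near. Qed.

Lemma cvg_cutoff_moment P phi ab : test_function phi -> quad_integrable P phi ->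
  moment P (fun x => phi x * cutoff n%:R x) ab @[n --> \oo] --> moment P phi ab.
Proof.
move=> [mphi phi01] Iphi.
apply: (@cvg_Rintegral _ _ _ P _ _ (fun x => `|phi x * quad ab x|)).
- move=> n; apply: measurable_funM; last exact: measurable_quad.
  by apply: measurable_funM => //; case: (@cutoff_test R k n%:R).
- by apply: measurable_funM => //; exact: measurable_quad.
- apply: aeW => x; apply: cvgM; last exact: cvg_cst.
  by rewrite -[X in _ --> X]mulr1; apply: cvgM; [exact: cvg_cst|exact: cvg_cutoff].
- exact: (integrable_norm (Iphi ab)).
- move=> n x; rewrite mulrAC normrM ler_piMr//.
  by apply: test_function_norm; exact: cutoff_test.
Qed.

Lemma bump_approximation Q gamma phi D : 0 < gamma -> gamma < 1 ->
  trimmingK Q gamma phi -> \det (trimmed_cov Q phi) < D ->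
  exists2 G, bump G & gamma < \int[Q]_x G x /\ \det (trimmed_cov Q G) < D.
Proof.
move=> gamma0 gamma1 Kphi; have tphi := trimmingK_test Kphi.
have Iphi := trimmingK_quad_integrable Kphi; have mass := trimmingK_mass Kphi.
have mass0 : \int[Q]_x phi x != 0 by rewrite gt_eqF// (lt_le_trans gamma0).
rewrite (trimmed_cov_moment Iphi mass0) => detD.
have det_near (M_ : nat -> option 'I_k * option 'I_k -> R) M :
    (forall ab, M_ n ab @[n --> \oo] --> M ab) -> M (None, None) != 0 ->
    \det (cov_of M) < D -> \forall n \near \oo, \det (cov_of (M_ n)) < D.
  move=> cM M0 MD; apply: (cvgr_lt (\det (cov_of M))) => //.
  by apply: cvg_det => i j; exact: cvg_cov_of.
pose good (M : option 'I_k * option 'I_k -> R) :=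
  gamma < M (None, None) /\ \det (cov_of M) < D.
have good_near (M_ : nat -> option 'I_k * option 'I_k -> R) M :
    (forall ab, M_ n ab @[n --> \oo] --> M ab) -> good M -> exists n, good (M_ n).
  move=> cM [gM MD].
  have M0 : M (None, None) != 0 by rewrite gt_eqF// (lt_trans gamma0).
  have near_mass : \forall n \near \oo, gamma < M_ n (None, None).
    by apply: (cvgr_gt (M (None, None))) => //; exact: cM.
  by have [n ?] := filter_ex (filterI near_mass (det_near _ _ cM M0 MD)); exists n.
have [N1 massN1] : exists N1 : nat, gamma < \int[Q]_x cutoff N1%:R x.
  have cc : \int[Q]_x cutoff n%:R x @[n --> \oo] --> \int[Q]_x cst 1 x.
    apply: (@cvg_Rintegral_bounded _ _ _ Q _ _ 1) => //.
    - by move=> n; case: (@cutoff_test R k n%:R).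
    - by apply: aeW => x; exact: cvg_cutoff.
    - by move=> n x; apply: test_function_norm; exact: cutoff_test.
  have : \forall n \near \oo, gamma < \int[Q]_x cutoff n%:R x.
    apply: (cvgr_gt (\int[Q]_x cst 1 x)) => //.
    by rewrite Rintegral_cst// [X in fine X]probability_setT mulr1.
  by move=> /filter_ex[n ?]; exists n.
pose m := moment Q phi; pose q := moment Q (cutoff N1%:R).
pose mix (s : R) (M : option 'I_k * option 'I_k -> R) ab := (1 - s) * M ab + s * q ab.
have cvg_mix s (M_ : nat -> option 'I_k * option 'I_k -> R) M :
    (forall ab, M_ n ab @[n --> \oo] --> M ab) ->
    forall ab, mix s (M_ n) ab @[n --> \oo] --> mix s M ab.
  move=> cM ab; apply: cvgD; last exact: cvg_cst.
  by apply: cvgM => //; exact: cvg_cst.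
(* Any positive [s] lifts the mass strictly above [gamma], as [phi] has mass at least [gamma] and
   the cutoff more. Letting [s] tend to 0 keeps the determinant below [D]. *)
have [s s01 good_s] : exists2 s, 0 <= s <= 1 & good (mix s m).
  have cm ab : mix (n.+1%:R^-1) m ab @[n --> \oo] --> m ab.
    rewrite -[X in _ --> X]addr0 -[X in _ --> X + _]mul1r -[X in _ --> _ + X](mul0r (q ab)).
    apply: cvgD; apply: cvgM; try exact: cvg_cst; last exact: cvg_harmonic.
    rewrite -[X in _ --> X]subr0; apply: cvgB; [exact: cvg_cst|exact: cvg_harmonic].
  have m0 : m (None, None) != 0 by rewrite /m moment_mass.
  have [n Dn] := filter_ex (det_near _ _ cm m0 detD).
  have n0 : 0 < n.+1%:R^-1 :> R by rewrite invr_gt0 ltr0n.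
  have n1 : n.+1%:R^-1 <= 1 :> R by rewrite invf_le1 ?ltr0n// ler1n.
  exists (n.+1%:R^-1); first by rewrite (ltW n0).
  split => //; rewrite /mix /m /q !moment_mass.
  by move: (n.+1%:R^-1) n0 n1 => s s0 s1; nra.
have [N good_N] := good_near _ _ (cvg_mix s _ _
  (fun ab => @cvg_cutoff_moment Q phi ab tphi Iphi)) good_s.
(* Applied to a constant sequence of measures and of functions, [weak_limit_moments] becomes a
   density statement: continuous functions approximate the moments of the truncated [phi]. *)
have Qcst : weak_cvg (fun=> Q) Q by move=> f _ _; exact: cvg_cst.
have [||g_ [g tg [bg cg _]]] := @weak_limit_moments R k (fun=> Q) Q (fun=> phi) N%:R
    (moment Q (fun x => phi x * cutoff N%:R x)) Qcst.
- by [].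
- by move=> ab; exact: cvg_cst.
have [n [good1 good2]] := good_near _ _ (cvg_mix s _ _ cg) good_N.
pose G x := (1 - s) * (g_ n x * cutoff N%:R x) + s * cutoff N1%:R x.
have bG : bump G by apply: bump_convex => //; exact: bump_cutoff.
have momG : moment Q G = mix s (moment Q (fun x => g_ n x * cutoff N%:R x)).
  apply/funext => ab; apply: moment_convex; first exact: bump_quad_integrable.
  by apply: bump_quad_integrable; exact: bump_cutoff.
have massG : gamma < \int[Q]_x G x by rewrite -moment_mass momG.
exists G => //; split => //; rewrite trimmed_cov_moment ?momG//.
  exact: bump_quad_integrable.
by rewrite gt_eqF// (lt_trans gamma0).
Qed.

(** Here [1 - f] is nonnegative with integral at most 0, so [f] is 1 almost everywhere. For
    [gamma = 1] all admissible functions therefore share their moments. *)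
Lemma full_mass_moment Q f ab : test_function f -> 1 <= \int[Q]_x f x ->
  moment Q f ab = \int[Q]_x quad ab x.
Proof.
move=> tf f1; have [mf f01] := tf.
have If : Q.-integrable setT (EFin \o f).
  by apply: (@bounded_integrable _ _ _ _ _ 1) => // x; exact: test_function_norm.
have I1 : Q.-integrable setT (EFin \o cst 1).
  exact: finite_measure_integrable_cst.
have I1f : Q.-integrable setT (EFin \o (fun x => cst 1 x - f x)).
  exact: (integrableB measurableT I1 If).
have ge0 x : 0 <= 1 - f x by have := f01 x; lra.
have f_ae : ae_eq Q setT (EFin \o (fun x => cst 1 x - f x)) (cst 0%E).
  apply/ae_eq_integral_abs => //; first exact: measurable_int I1f.
  under eq_integral => x _ do rewrite gee0_abs ?lee_fin//.
  have E : \int[Q]_x (cst 1 x - f x) = 0.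
    apply/eqP; rewrite eq_le; apply/andP; split; last exact: Rintegral_ge0.
    rewrite (RintegralB measurableT I1 If) Rintegral_cst//.
    by rewrite [X in fine X]probability_setT mul1r subr_le0.
  move: E; rewrite /Rintegral => E.
  by rewrite -[LHS]fineK ?E//; exact: integrable_fin_num I1f.
congr fine; apply: ae_eq_integral => //.
- by apply/measurable_EFinP; apply: measurable_funM => //; exact: measurable_quad.
- by apply/measurable_EFinP; exact: measurable_quad.
- apply: filterS f_ae => x /(_ I) [/eqP]; rewrite subr_eq0 => /eqP <- _.
  by rewrite mul1r.
Qed.

End approximation.

(** * Recovering moments from mean and covariance, and competitors admissible for large index *)

Section limit_points.
Context {R : realType} {k : nat}.
Implicit Types (phi : 'cV[R]_k -> R) (P Q : probability 'cV[R]_k R).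
Implicit Types (gamma : R).

(** Inverse to [mean_of] and [cov_of] once the mass [c] is given: it turns convergence of means and
    covariances back into convergence of moments. *)
Definition moments_of (c : R) (T : 'cV[R]_k) (C : 'M[R]_k)
    (ab : option 'I_k * option 'I_k) : R :=
  match ab with
  | (None, None) => c
  | (None, Some i) | (Some i, None) => c * T i 0
  | (Some i, Some j) => c * (C i j + T i 0 * T j 0)
  end.

Lemma mean_of_moments_of c T C : c != 0 -> mean_of (moments_of c T C) = T.
Proof. by move=> c0; apply/colP => i; rewrite mxE/= mulKf. Qed.

Lemma cov_of_moments_of c T C : c != 0 -> cov_of (moments_of c T C) = C.
Proof.
by move=> c0; apply/matrixP => i j; rewrite mxE mean_of_moments_of//= mulKf// addrK.
Qed.

Lemma moment_moments_of P phi : quad_integrable P phi ->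
  \int[P]_x phi x != 0 ->
  moment P phi = moments_of (\int[P]_x phi x) (trimmed_mean P phi) (trimmed_cov P phi).
Proof.
move=> Iphi m0; rewrite trimmed_mean_moment trimmed_cov_moment//.
have quadC i : moment P phi (Some i, None) = moment P phi (None, Some i).
  by apply: eq_Rintegral => x _; rewrite /quad/= mulr1 mul1r.
by apply/funext => -[[i|] [j|]] /=; rewrite ?quadC ?mxE ?subrK -?moment_mass ?mulVKf// moment_mass.
Qed.

Lemma cvg_moments_of (c_ : nat -> R) (T_ : nat -> 'cV[R]_k) (C_ : nat -> 'M[R]_k) c T C :
  c_ n @[n --> \oo] --> c -> T_ n @[n --> \oo] --> T -> C_ n @[n --> \oo] --> C ->
  forall ab, moments_of (c_ n) (T_ n) (C_ n) ab @[n --> \oo] --> moments_of c T C ab.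
Proof.
move=> cc cT cC.
have cTi i : T_ n i 0 @[n --> \oo] --> T i 0.
  exact: (cvg_comp _ _ cT (@coord_continuous R k 1 i 0 T)).
have cCi i j : C_ n i j @[n --> \oo] --> C i j.
  exact: (cvg_comp _ _ cC (@coord_continuous R k k i j C)).
by move=> [[i|] [j|]] //=; apply: cvgM => //; apply: cvgD => //; exact: cvgM.
Qed.

(** The mass of [G] under [P_ n] is known to be positive only for large [n], so the moment formula
    for the covariance is used eventually. *)
Lemma weak_cvg_det (P_ : nat -> probability 'cV[R]_k R) Q G : weak_cvg P_ Q ->
  bump G -> 0 < \int[Q]_x G x ->
  \det (trimmed_cov (P_ n) G) @[n --> \oo] --> \det (trimmed_cov Q G).
Proof.
move=> PQ bG Q0; have cG := weak_cvg_moment PQ bG.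
have IG P : quad_integrable P G by exact: bump_quad_integrable.
have Q0' : \int[Q]_x G x != 0 by rewrite gt_eqF.
rewrite (trimmed_cov_moment (IG Q) Q0').
have cdet : \det (cov_of (moment (P_ n) G)) @[n --> \oo] --> \det (cov_of (moment Q G)).
  by apply: cvg_det => i j; apply: cvg_cov_of => //; rewrite moment_mass.
apply: cvg_trans cdet; apply: near_eq_cvg.
have : \forall n \near \oo, 0 < moment (P_ n) G (None, None).
  by apply: (cvgr_gt (moment Q G (None, None))) => //; rewrite moment_mass.
apply: filterS => n Pn0; rewrite trimmed_cov_moment//.
by rewrite -moment_mass gt_eqF.
Qed.

Lemma weak_cvg_subseq (P_ : nat -> probability 'cV[R]_k R) Q (s : nat -> nat) :
  weak_cvg P_ Q -> increasing_seq s -> weak_cvg (P_ \o s) Q.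
Proof.
move=> PQ incs f cf bf.
exact: (cvg_comp _ _ (increasing_seq_cvgy incs) (PQ f cf bf)).
Qed.

(* When [gamma = 1] no mass can be added to an approximating bump; instead the
   measures are then eventually carried by a fixed ball, and a cutoff is 1 almost
   surely. *)
Lemma trimming_upper_bound (P_ : nat -> probability 'cV[R]_k R) Q
    (psi_ : nat -> 'cV[R]_k -> R) gamma (r e : R) phi :
  0 < gamma -> gamma <= 1 -> weak_cvg P_ Q ->
  (\forall n \near \oo, trimmingK (P_ n) gamma (psi_ n)) ->
  (\forall n \near \oo, forall x, psi_ n x * cutoff r x = psi_ n x) ->
  trimmingK Q gamma phi -> 0 < e ->
  exists2 G, bump G &
    [/\ \forall n \near \oo, trimmingK (P_ n) gamma G, 0 < \int[Q]_x G x &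
        \det (trimmed_cov Q G) <= \det (trimmed_cov Q phi) + e].
Proof.
move=> gamma0 gamma1 PQ Kpsi psi_r Kphi e0.
have [g1|/(conj gamma1)/andP] := ltP gamma 1; last first.
  rewrite -eq_le => /eqP gE; subst gamma.
  exists (cutoff r); first exact: bump_cutoff.
  have bc := @bump_cutoff R k r; have tc := bump_test bc.
  have sc : bounded_support (@cutoff R k r) by case: bc.
  have Kc : \forall n \near \oo, trimmingK (P_ n) 1 (cutoff r).
    apply: filterS2 Kpsi psi_r => n Kn rn; apply: supported_trimmingK => //.
    apply: (le_trans (trimmingK_mass Kn)); apply: le_Rintegral => //.
    - exact: quad_integrable_mass (trimmingK_quad_integrable Kn).
    - by apply: quad_integrable_mass; exact: bump_quad_integrable.
    - move=> x _; rewrite -(rn x); have [_ /(_ x)] := tc.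
      by have [_ /(_ x)] := trimmingK_test Kn; nra.
  have mc : 1 <= \int[Q]_x cutoff r x.
    rewrite -moment_mass; apply: (cvgr_to_ge (@weak_cvg_moment _ _ _ _ _ PQ bc (None, None))).
    by apply: filterS Kc => n /trimmingK_mass; rewrite moment_mass.
  split => //; first exact: lt_le_trans mc.
  rewrite !trimmed_cov_moment.
  - rewrite (_ : moment Q (cutoff r) = moment Q phi) ?lerDl ?ltW//.
    apply/funext => ab; rewrite !full_mass_moment//; first exact: trimmingK_test Kphi.
    exact: trimmingK_mass Kphi.
  - exact: trimmingK_quad_integrable Kphi.
  - by rewrite gt_eqF// (lt_le_trans ltr01)//; exact: trimmingK_mass Kphi.
  - exact: bump_quad_integrable.
  - by rewrite gt_eqF// (lt_le_trans ltr01).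
have De : \det (trimmed_cov Q phi) < \det (trimmed_cov Q phi) + e by rewrite ltrDl.
have [G bG [mG dG]] := bump_approximation gamma0 g1 Kphi De.
exists G => //; split; [|exact: lt_trans mG|exact: ltW].
have : \forall n \near \oo, gamma < moment (P_ n) G (None, None).
  apply: (cvgr_gt _ (@weak_cvg_moment _ _ _ _ _ PQ bG (None, None))).
  by rewrite moment_mass.
apply: filterS => n; rewrite moment_mass => mn; apply: supported_trimmingK.
- exact: bump_test.
- by case: bG.
- exact: ltW.
Qed.

End limit_points.

(* The limit measure is [P 0]; the sequence is [P t] for [t >= 1]. The values of
   [psi] and [phi] at 0 are irrelevant. *)
Theorem theorem4p1 (R : realType) (k : nat) (gamma : R)
  (P : nat -> probability 'cV[R]_k R)
  (psi phi : nat -> 'cV[R]_k -> R)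
  (k_ge1 : (1 <= k)%N)
  (gamma_gt0 : 0 < gamma) (gamma_le1 : gamma <= 1)
  (P0_hyperplane : forall H : set 'cV[R]_k, hyperplanes H ->
     (P 0%N H < gamma%:E)%E)
  (P_weak : weak_cvg P (P 0%N))
  (P_ellipsoids :
     (ereal_sup [set `|P t E - P 0%N E| | E in @ellipsoids R k]
        @[t --> \oo] --> 0)%E)
  (psi_K : forall t : nat, (1 <= t)%N -> trimmingK (P t) gamma (psi t))
  (psi_posdef : forall t : nat, (1 <= t)%N ->
     posdefmx (trimmed_cov (P t) (psi t)))
  (psi_le : forall t : nat, (1 <= t)%N -> forall x : 'cV[R]_k,
     psi t x <= \1_(ellipsoid (trimmed_mean (P t) (psi t))
                              (trimmed_cov (P t) (psi t))
                              (mcd_radius (P t) gamma (psi t))) x)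
  (psi_supp : exists2 r : R, 0 < r &
     \forall t \near \oo, forall x : 'cV[R]_k, psi t x != 0 -> enorm x <= r)
  (phi_min : forall t : nat, (1 <= t)%N -> mcd_minimizer (P t) gamma (phi t))
  (det_cvg : \det (trimmed_cov (P t) (psi t)) - \det (trimmed_cov (P t) (phi t))
     @[t --> \oo] --> 0) :
  (exists s : nat -> nat,
     [/\ increasing_seq s, (forall m, (1 <= s m)%N) &
         exists L : 'cV[R]_k * 'M[R]_k,
           (trimmed_mean (P (s m)) (psi (s m)),
            trimmed_cov (P (s m)) (psi (s m))) @[m --> \oo] --> L])
  /\
  (forall (s : nat -> nat) (L : 'cV[R]_k * 'M[R]_k),
     increasing_seq s -> (forall m, (1 <= s m)%N) ->
     (trimmed_mean (P (s m)) (psi (s m)),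
      trimmed_cov (P (s m)) (psi (s m))) @[m --> \oo] --> L ->
     exists2 phi0 : 'cV[R]_k -> R, mcd_minimizer (P 0%N) gamma phi0 &
       L = (trimmed_mean (P 0%N) phi0, trimmed_cov (P 0%N) phi0)).
Proof.
have [r r0 suppr] := psi_supp.
have psi_r : \forall t \near \oo, forall x, psi t x * cutoff r x = psi t x.
  apply: filterS suppr => t supp x.
  have [->|psix] := eqVneq (psi t x) 0; first by rewrite mul0r.
  by rewrite cutoff1 ?mulr1//; apply: le_trans (norm_le_enorm x) (supp x psix).
have psi_test t : (1 <= t)%N -> test_function (psi t).
  by move=> t1; exact: trimmingK_test (psi_K _ t1).
have psi_quad t : (1 <= t)%N -> quad_integrable (P t) (psi t).
  by move=> t1; exact: trimmingK_quad_integrable (psi_K _ t1).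
have psi_mass t : (1 <= t)%N -> gamma <= \int[P t]_x psi t x.
  by move=> t1; exact: trimmingK_mass (psi_K _ t1).
have psi_mass0 t : (1 <= t)%N -> \int[P t]_x psi t x != 0.
  by move=> t1; rewrite gt_eqF// (lt_le_trans gamma_gt0)// psi_mass.
have [_ cut01 cut_supp] := @bump_cutoff R k r.
split.
- have [B HB] := supported_quad_bounded cut01 cut_supp.
  have [N0 _ HN0] := psi_r.
  (* The shift passes the index [N0] from which the cutoff leaves [psi] unchanged, and the successor
     keeps every index at least 1. *)
  pose u n ab := moment (P (n + N0.+1)%N) (psi (n + N0.+1)%N) ab.
  have t1 n : (1 <= n + N0.+1)%N by rewrite addnS.
  have uB n ab : `|u n ab| <= B.
    have [mpsi psi01] := psi_test _ (t1 n).
    apply: norm_Rintegral_le.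
      by apply: measurable_funM => //; exact: measurable_quad.
    move=> x; have N0n : (N0 <= n + N0.+1)%N by rewrite addnS ltnW// ltnS leq_addl.
    rewrite -(HN0 _ N0n x) -mulrA.
    exact: (@test_function_mul_le _ _ _ _ (fun y => cutoff r y * quad ab y) _ _
      (psi_test _ (t1 n)) (HB ab x)).
  have [f incf cf] := bolzano_weierstrass_family uB.
  pose l ab := limn (fun n => u (f n) ab).
  have l0 : l (None, None) != 0.
    rewrite gt_eqF// (lt_le_trans gamma_gt0)//.
    rewrite /l; apply: limr_ge; first exact: cf.
    apply: nearW => n.
    by rewrite /u moment_mass psi_mass.
  have cl ab : u (f n) ab @[n --> \oo] --> l ab by exact: cf.
  exists (fun m => f m + N0.+1)%N; split.
  + by move=> n m /=; rewrite !leEnat leq_add2r -leEnat incf.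
  + by move=> m; exact: t1.
  + have cT : trimmed_mean (P (f m + N0.+1)%N) (psi (f m + N0.+1)%N) @[m --> \oo] -->
        mean_of l.
      under eq_cvg do rewrite trimmed_mean_moment.
      by apply: cvg_mx_entries => i j; exact: (@cvg_mean_of _ _ _ _ _ _ _ cl l0 i j).
    have cC : trimmed_cov (P (f m + N0.+1)%N) (psi (f m + N0.+1)%N) @[m --> \oo] -->
        cov_of l.
      have covE m := trimmed_cov_moment (psi_quad _ (t1 (f m))) (psi_mass0 _ (t1 (f m))).
      under eq_cvg do rewrite covE.
      by apply: cvg_mx_entries => i j; exact: (@cvg_cov_of _ _ _ _ _ _ _ cl l0 i j).
    by exists (mean_of l, cov_of l); exact: cvg_pair cT cC.
- move=> s [T C] incs s1 cTC.
  have cT : trimmed_mean (P (s m)) (psi (s m)) @[m --> \oo] --> T.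
    exact: (cvg_comp _ _ cTC cvg_fst).
  have cC : trimmed_cov (P (s m)) (psi (s m)) @[m --> \oo] --> C.
    exact: (cvg_comp _ _ cTC cvg_snd).
  (* Mean and covariance do not determine the mass, so a further subsequence makes the masses
     converge; its limit is at least [gamma]. *)
  have [|f incf cf] := @bolzano_weierstrass R (fun n => \int[P (s n)]_x psi (s n) x).
    exists 1; split => // M M1 n _ /=; apply: le_trans (ltW M1).
    have [mpsi _] := psi_test _ (s1 n); apply: norm_Rintegral_le => // x.
    by apply: test_function_norm; exact: psi_test.
  set c := limn _ in cf.
  have gc : gamma <= c by apply: limr_ge => //; apply: nearW => n; exact: psi_mass.
  have c0 : c != 0 by rewrite gt_eqF// (lt_le_trans gamma_gt0).
  have foo := increasing_seq_cvgy incf.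
  have incsf : increasing_seq (s \o f) by exact: increasing_seq_comp.
  have cM ab : moment (P (s (f n))) (fun x => psi (s (f n)) x * cutoff r x) ab
      @[n --> \oo] --> moments_of c T C ab.
    have cmo := @cvg_moments_of _ _ _ _ _ _ _ _ cf (cvg_comp _ _ foo cT) (cvg_comp _ _ foo cC) ab.
    apply: cvg_trans cmo; apply: near_eq_cvg.
    have psi_sf : \forall n \near \oo, forall x,
        psi (s (f n)) x * cutoff r x = psi (s (f n)) x.
      exact: (@increasing_seq_cvgy _ incsf _ psi_r).
    apply: filterS psi_sf => n psin /=.
    rewrite -moment_moments_of; [|exact: psi_quad|exact: psi_mass0].
    by apply: eq_Rintegral => x _; rewrite psin.
  have [_ [g tg [_ _ Eg]]] :=
    weak_limit_moments (weak_cvg_subseq P_weak incsf)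
      (fun n => psi_test _ (s1 (f n))) cM.
  pose phi0 x := g x * cutoff r x.
  have tphi0 : test_function phi0 by apply: test_mul => //; exact: cutoff_test.
  have supp0 : bounded_support phi0.
    by have [B HB] := cut_supp; exists B => x /HB; rewrite /phi0 => ->; rewrite mulr0.
  have mom0 : moment (P 0%N) phi0 = moments_of c T C by apply/funext => ab; exact: Eg.
  have mass0 : \int[P 0%N]_x phi0 x = c by rewrite -moment_mass mom0.
  have K0 : trimmingK (P 0%N) gamma phi0 by apply: supported_trimmingK => //; rewrite mass0.
  have T0 : trimmed_mean (P 0%N) phi0 = T.
    by rewrite trimmed_mean_moment mom0 mean_of_moments_of.
  have C0 : trimmed_cov (P 0%N) phi0 = C.
    rewrite trimmed_cov_moment ?mass0// ?mom0 ?cov_of_moments_of//.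
    exact: trimmingK_quad_integrable K0.
  exists phi0; last by rewrite T0 C0.
  split => // phi' Kphi'; rewrite C0; apply/ler_addgt0Pr => e e0.
  have Kpsi : \forall t \near \oo, trimmingK (P t) gamma (psi t).
    by near=> t; apply: psi_K; near: t; exact: nbhs_infty_ge.
  have [G bG [KG mG dG]] :=
    trimming_upper_bound gamma_gt0 gamma_le1 P_weak Kpsi psi_r Kphi' e0.
  apply: le_trans dG.
  have soo := increasing_seq_cvgy incs.
  have cdetC : \det (trimmed_cov (P (s m)) (psi (s m))) @[m --> \oo] --> \det C.
    by apply: cvg_det => i j; exact: (cvg_comp _ _ cC (@coord_continuous R k k i j C)).
  (* The subtraction rewrites the minimal determinant under [P (s m)], so that it too tends to
     [\det C]. Being minimal, it is at most the determinant of [G] under [P (s m)], and weak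
     convergence handles the latter. *)
  have cdetphi : \det (trimmed_cov (P (s m)) (psi (s m))) -
      (\det (trimmed_cov (P (s m)) (psi (s m))) - \det (trimmed_cov (P (s m)) (phi (s m))))
      @[m --> \oo] --> \det C.
    rewrite -[X in _ --> X]subr0; apply: cvgB => //.
    exact: (cvg_comp _ _ soo det_cvg).
  apply: (ler_cvg_to cdetphi (cvg_comp _ _ soo (weak_cvg_det P_weak bG mG))).
  have KsG : \forall m \near \oo, trimmingK (P (s m)) gamma G by exact: soo _ KG.
  apply: filterS KsG => m Km /=.
  by rewrite subKr; have [_] := phi_min _ (s1 m); apply.
Unshelve. all: by end_near. Qed.
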